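(* Let $G$ be a graph, let $d(G)$ be the number of dominating sets of $G$, and let $\mathrm{Con}(G)$ be the set of all vertex-induced conformal subgraphs of $G$. Then $$d(G)=\sum_{H\in\mathrm{Con}(G)}2^{k(H)},$$ where $k(H)$ denotes the number of components of $H$.
   Context: All graphs are finite, simple and undirected. For a graph $G=(V,E)$, the closed neighborhood $N_G[v]$ of a vertex $v$ is the set consisting of $v$ and all its neighbors, and $N_G[W]=\bigcup_{v\in W}N_G[v]$ for $W\subseteq V$. A set $W\subseteq V$ is dominating in $G$ if $N_G[W]=V$. For $W\subseteq V$, the vertex-induced subgraph $G[W]$ has vertex set $W$ and all edges of $G$ with both end vertices in $W$; distinct subsets $W$ give distinct vertex-induced subgraphs (subgraphs are not identified up to isomorphism). A graph is called conformal if all of its components are of even order (have an even number of vertices). The null graph $G[\emptyset]$ is conformal and has no components. *)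

(* Defs.v *)
From mathcomp Require Import all_boot.

Set Implicit Arguments.
Unset Strict Implicit.
Unset Printing Implicit Defensive.

Record sgraph := SGraph {
  vertex :> finType;
  edge : rel vertex;
  edge_sym : symmetric edge;
  edge_irrefl : irreflexive edge
}.

Definition closed_nbhd (G : sgraph) (v : G) : {set G} :=
  v |: [set w | edge v w].

Definition closed_nbhds (G : sgraph) (W : {set G}) : {set G} :=
  \bigcup_(v in W) closed_nbhd v.

Definition dominating (G : sgraph) (W : {set G}) : bool :=
  closed_nbhds W == [set: G].

Definition num_dominating (G : sgraph) : nat :=
  #|[set W : {set G} | dominating W]|.

Definition induced_edge (G : sgraph) (W : {set G}) : rel {x : G | x \in W} :=
  [rel x y | edge (val x) (val y)].

Lemma induced_edge_sym (G : sgraph) (W : {set G}) : symmetric (@induced_edge G W).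
Proof. by move=> x y; apply: edge_sym. Qed.

Lemma induced_edge_irrefl (G : sgraph) (W : {set G}) :
  irreflexive (@induced_edge G W).
Proof. by move=> x; apply: edge_irrefl. Qed.

Definition induced (G : sgraph) (W : {set G}) : sgraph :=
  SGraph (@induced_edge_sym G W) (@induced_edge_irrefl G W).

(* A component is identified with its vertex set, that is, with a class of the
   relation "joined by a path". *)
Definition components (G : sgraph) : {set {set G}} :=
  equivalence_partition (connect (@edge G)) [set: G].

Definition num_components (G : sgraph) : nat := #|components G|.

Definition conformal (G : sgraph) : bool :=
  [forall C in components G, ~~ odd #|C|].

(* Distinct vertex sets give distinct induced subgraphs (no identification up
   to isomorphism), so each induced subgraph is represented by its vertex set. *)
Definition Con (G : sgraph) : {set {set G}} :=
  [set W | conformal (induced W)].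

(* Main.v *)
(* By inclusion-exclusion over the set U of undominated vertices, d(G) is the
   sum of (-1)^|U| over all pairs (W, U) of disjoint vertex sets with no edge
   between them.  Grouping these pairs by S = U :|: W, the set U runs over the
   unions of components of G[S], so S contributes the product of 1 + (-1)^|C|
   over the components C of G[S], which is 2^k if all the |C| are even and 0
   otherwise. *)
Require Import Defs.
From mathcomp Require Import all_boot all_algebra.

Set Implicit Arguments.
Unset Strict Implicit.
Unset Printing Implicit Defensive.

Import GRing.Theory Num.Theory.

Section SignedSums.
Local Open Scope ring_scope.

Lemma sum_subset_prod (I : finType) (A : {set I}) (f : I -> int) :
  \sum_(J : {set I} | J \subset A) \prod_(i in J) f i
    = \prod_(i in A) (1 + f i).
Proof.
(* Extending [f] by 0 outside [A] turns the right side into a product over all of [I]. In its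
   expansion every [J] not contained in [A] picks up a factor 0. *)
have -> : \prod_(i in A) (1 + f i)
    = \prod_i ((if i \in A then f i else 0) + 1).
  by rewrite big_mkcond; apply: eq_bigr => i _; case: ifP; rewrite ?add0r 1?addrC.
rewrite bigA_distr [LHS]big_mkcond; apply: eq_bigr => J _.
have [sJA|/subsetPn[i iJ /negbTE iA]] := ifPn.
  rewrite big_mkcond; apply: eq_bigr => i _.
  by case: ifP => // /(subsetP sJA) ->.
by rewrite (bigD1 i) //= iJ iA mul0r.
Qed.

(** The case [f = -1] of [sum_subset_prod], where the product is [0 ^+ #|A|]. With [A] the set of
    vertices that [W] leaves undominated, it is the indicator of [W] being dominating. *)
Lemma sum_subset_sign (T : finType) (A : {set T}) :
  \sum_(U : {set T} | U \subset A) (-1) ^+ #|U| = (A == set0)%:R :> int.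
Proof.
under eq_bigr do rewrite -prodr_const.
rewrite (sum_subset_prod A (fun=> -1)) subrr prodr_const expr0n.
by rewrite cards_eq0.
Qed.

Lemma sign_cover (T : finType) (J : {set {set T}}) : trivIset J ->
  (-1) ^+ #|cover J| = \prod_(C in J) (-1) ^+ #|C| :> int.
Proof. by move=> /eqP <-; rewrite prodrXr. Qed.

End SignedSums.

Section Separation.
Variable G : sgraph.
Implicit Types U W S : {set G}.

(** Written as an inclusion so that, for fixed [W], the sets [U] are the subsets of one set, as
    [sum_subset_sign] requires. The symmetric reading is [separatedP]. *)
Definition separated U W : bool := U \subset ~: closed_nbhds W.

Lemma separatedP U W :
  reflect {in U & W, forall x y, x != y /\ ~~ edge x y} (separated U W).
Proof.
apply: (iffP subsetP) => [sep x y xU yW | sep x xU].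
  have := sep x xU; rewrite inE => /bigcupP xNW.
  split; apply/negP => exy; apply: xNW; exists y => //.
    by rewrite (eqP exy) setU11.
  by rewrite !inE edge_sym exy orbT.
rewrite inE; apply/bigcupP => -[y yW]; rewrite !inE edge_sym.
by have [/negbTE-> /negbTE->] := sep x y xU yW.
Qed.

Lemma separated_closedP U :
  reflect (closed (@edge G) U) (separated U (~: U)).
Proof.
apply: (iffP (separatedP _ _)) => [sep x y exy | clU x y xU].
  apply/idP/idP => inU; apply/idPn => ninU.
    by have [|_] := sep x y inU; rewrite ?inE ?exy.
  by have [|_] := sep y x inU; rewrite ?inE // edge_sym exy.
rewrite inE => yU; split; first by apply: contraNneq yU => <-.
by apply: contra yU => /clU <-.
Qed.

End Separation.

Section Components.
Variable G : sgraph.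
Implicit Types (U : {set G}) (J : {set {set G}}).

Let symG : connect_sym (@edge G) := sym_connect_sym (@edge_sym G).

Lemma connect_edge_equiv :
  {in [set: G] & &, equivalence_rel (connect (@edge G))}.
Proof.
by move=> x y z _ _ _; split=> [|cxy]; [apply: connect0 | apply: same_connect].
Qed.

Lemma components_partition : partition (components G) [set: G].
Proof. exact: equivalence_partitionP connect_edge_equiv. Qed.

Lemma components_trivIset : trivIset (components G).
Proof. by case/and3P: components_partition. Qed.

Lemma component_closed C : C \in components G -> closed (@edge G) C.
Proof.
case/imsetP=> x _ -> y z eyz; rewrite !inE.
by rewrite !(symG x); apply: same_connect (connect1 eyz) _.
Qed.

Lemma cover_components_closed J :
  J \subset components G -> closed (@edge G) (cover J).
Proof.
move=> /subsetP sJ x y exy; apply/bigcupP/bigcupP => -[C CJ inC]; exists C => //.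
  by rewrite -(component_closed (sJ C CJ) exy).
by rewrite (component_closed (sJ C CJ) exy).
Qed.

Lemma component_sub_closed U C x : closed (@edge G) U ->
  C \in components G -> x \in C -> x \in U -> C \subset U.
Proof.
move=> clU /imsetP[y _ ->]; rewrite !inE => /(closed_connect clU) <- yU.
by apply/subsetP => z; rewrite !inE => /(closed_connect clU) <-.
Qed.

(** Together with [components_in_cover], this makes [cover] a bijection from sets of components onto
    closed vertex sets. The inverse collects the components contained in [U]. *)
Lemma cover_components_in U : closed (@edge G) U ->
  cover (components G ::&: U) = U.
Proof.
move=> clU; apply/setP => x; apply/bigcupP/idP => [[C]|xU].
  by rewrite inE => /andP[_ /subsetP]; apply.
have xC : x \in pblock (components G) x.
  by rewrite mem_pblock (cover_partition components_partition).
have CG : pblock (components G) x \in components G.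
  by rewrite pblock_mem // (cover_partition components_partition).
exists (pblock (components G) x) => //.
by rewrite inE CG (component_sub_closed _ CG xC).
Qed.

Lemma components_in_cover J : J \subset components G ->
  components G ::&: cover J = J.
Proof.
move=> sJ; apply/setP => C; rewrite inE.
apply/andP/idP => [[CG CJ]|CJ]; last first.
  by split; [apply: (subsetP sJ) | apply: bigcup_sup CJ].
have /set0Pn[x xC] : C != set0.
  by apply: contraTneq CG => ->; case/and3P: components_partition.
(* The components [C] and [D] share [x], so they coincide, and [C] is in [J]. *)
have /bigcupP[D DJ xD] := subsetP CJ x xC.
have tG := components_trivIset.
by rewrite -(def_pblock tG CG xC) (def_pblock tG (subsetP sJ D DJ) xD).
Qed.

Local Open Scope ring_scope.

Lemma sum_separated_compl :
  \sum_(U : {set G} | separated U (~: U)) (-1) ^+ #|U|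
    = (if conformal G then 2 ^ num_components G else 0)%N%:R :> int.
Proof.
rewrite (reindex_onto (@cover G) (fun U => components G ::&: U)) /=; last first.
  by move=> U /separated_closedP; apply: cover_components_in.
rewrite (eq_bigl (fun J => J \subset components G)) => [|J]; last first.
  apply/andP/idP => [[_ /eqP <-]|sJ]; first by apply/subsetP => C /[!inE] /andP[].
  split; last by rewrite components_in_cover.
  exact/separated_closedP/cover_components_closed.
under eq_bigr => J sJ do rewrite (sign_cover (trivIsetS sJ components_trivIset)).
rewrite sum_subset_prod; case: ifPn => [/forall_inP even|].
  under eq_bigr => C CG do rewrite -signr_odd (negbTE (even C CG)).
  by rewrite prodr_const natrX.
(* A single odd component gives the factor 1 + (-1) = 0. *)
rewrite negb_forall_in => /exists_inP[C CG /negPn oddC].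
by rewrite (bigD1 C) //= -signr_odd oddC mul0r.
Qed.

End Components.

Section InducedSubgraph.
Variables (G : sgraph) (S : {set G}).

Lemma separated_induced (U : {set induced S}) :
  separated (val @: U) (S :\: val @: U) = separated U (~: U).
Proof.
apply/separatedP/separatedP => sep x y.
  move=> xU; rewrite inE => yU.
  have [||xy exy] := sep (val x) (val y); first exact: imset_f.
    by rewrite inE mem_imset ?(valP y) ?yU //; apply: val_inj.
  by split=> //; apply: contraNneq xy => ->.
case/imsetP=> {}x xU -> /setDP[yS yU].
have [|xy exy] := sep x (Sub y yS) xU; last by [].
by rewrite inE; apply: contra yU => yU; apply/imsetP; exists (Sub y yS).
Qed.

(** Inside [induced S] the relative complement [S :\: U] becomes a plain complement, so
    [sum_separated_compl] applies to that graph. The injection [val] preserves cardinality, hence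
    the summand. *)
Lemma sum_induced (R : nmodType) (F : nat -> R) :
  (\sum_(U : {set G} | (U \subset S) && separated U (S :\: U)) F #|U|
    = \sum_(U : {set induced S} | separated U (~: U)) F #|U|)%R.
Proof.
rewrite (reindex_onto (fun U : {set induced S} => val @: U)
                      (fun U => val @^-1: U)) /=; last first.
  move=> U /andP[/subsetP sUS _]; apply/setP => x; apply/imsetP/idP.
    by case=> y; rewrite inE => yU ->.
  by move=> xU; exists (Sub x (sUS x xU)); rewrite ?inE.
apply: eq_big => [U|U _]; last by rewrite card_imset //; apply: val_inj.
rewrite separated_induced.
have -> : val @: U \subset S by apply/subsetP => _ /imsetP[x _ ->]; apply: valP.
have -> : val @^-1: (val @: U) = U.
  by apply/setP => x; rewrite inE mem_imset //; apply: val_inj.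
by rewrite eqxx andbT.
Qed.

End InducedSubgraph.

(** Separation forces [W] to be disjoint from [U], so [W] is recovered from [S = U :|: W] as
    [S :\: U]. *)
Lemma reindex_separated (G : sgraph) (R : nmodType) (U : {set G}) (c : R) :
  (\sum_(W | separated U W) c
    = \sum_(S : {set G} | (U \subset S) && separated U (S :\: U)) c)%R.
Proof.
rewrite (reindex_onto (fun S => S :\: U) (fun W => U :|: W)) /=.
  apply: eq_bigl => S; rewrite andbC; congr (_ && _).
  by rewrite setDE setUIr setUCr setIT; apply/eqP/setUidPr.
move=> W /separatedP sep; rewrite setDUl setDv set0U.
apply/setDidPl; rewrite disjoint_sym disjoints_subset; apply/subsetP => x xU.
by rewrite inE; apply/negP => /(sep x x xU)[/eqP].
Qed.

Theorem theorem13 (G : sgraph) :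
  num_dominating G = \sum_(W in Con G) 2 ^ num_components (induced W).
Proof.
apply/eqP; rewrite -(eqr_nat int) /num_dominating -sum1_card natr_sum.
apply/eqP.
transitivity (\sum_(W : {set G}) \sum_(U | separated U W) (-1) ^+ #|U| : int)%R.
  rewrite big_mkcond; apply: eq_bigr => W _.
  rewrite sum_subset_sign inE /dominating.
  by rewrite -[closed_nbhds W == _](inj_eq (@setC_inj _)) setCT; case: eqP.
(* The set [U] is moved outside so that [W] can be replaced by [S] while [U] is fixed. A second
   exchange then makes [S] the outer index. *)
rewrite (exchange_big_dep xpredT) //=.
under eq_bigr do rewrite reindex_separated.
rewrite (exchange_big_dep xpredT) //= big_mkcond /= natr_sum [RHS]big_mkcond /=.
apply: eq_bigr => S _.
rewrite (sum_induced S (fun n => (-1) ^+ n : int)%R) sum_separated_compl inE.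
by case: ifP.
Qed.
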